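(* Let $G$ be a finitely presented one-ended group and let $G\curvearrowright T$ be a non-trivial splitting with minimal action. Suppose the edge stabilizers are finitely generated, and suppose there is some edge $e$ whose stabilizer $G_e$ has more than one end. If the two halfspaces of $G\curvearrowright T$ associated to $e$ are one-ended, then $H^2(G,\mathbb ZG)\neq\{0\}$.
   Context: A splitting of a group $G$ is an action $G\curvearrowright T$ on a simplicial tree without edge inversions. It is non-trivial if $G$ has no global fixed point in $T$, and minimal if $T$ has no proper $G$-invariant subtree. Halfspaces of a tree: for an edge $e$ of $T$ with midpoint $\hat e$, a halfspace of $T$ bounded by $\hat e$ is the union of $\hat e$ with one of the two components of $T-\hat e$. Halfspaces of a splitting: let $G\curvearrowright T$ be a splitting of a finitely generated group with minimal action and finitely generated edge stabilizers. Fix an orbit map $f:G\to VT$, $f(g)=gv$, and a finite generating set $S$ of $G$ such that for every halfspace $\mathfrak h$ of $T$ the induced subgraph of $f^{-1}(\mathfrak h)$ in the Cayley graph $\mathrm{Cay}(G,S)$ is connected (such $S$ exists). These induced subgraphs, with their induced path metrics, are the halfspaces of $G\curvearrowright T$; the two arising from the halfspaces of $T$ bounded by $\hat e$ are those associated to $e$. Up to quasi-isometry they do not depend on $f$ and $S$, so one-endedness of halfspaces is well-defined. A connected locally finite graph is one-ended if it is infinite and for every finite subgraph $K$ the complement of $K$ has exactly one unbounded component; it has more than one end if some finite subgraph has at least two unbounded complementary components. The ends of a finitely generated group are those of any of its Cayley graphs with respect to finite generating sets. *)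

(* Defs.v *)
From HB Require Import structures.
From mathcomp Require Import all_boot all_order all_algebra ssrAC finmap.
From mathcomp Require Import boolp classical_sets functions cardinality.
From mathcomp.multinomials Require Import monalg.

Set Implicit Arguments.
Unset Strict Implicit.
Unset Printing Implicit Defensive.

Import GRing.Theory.
Local Open Scope classical_set_scope.
Local Open Scope ring_scope.
Local Open Scope quotient_scope.

(** * Graphs and ends *)

(* A graph is given by a type of vertices [X] with an adjacency relation [e];
   a set [A] of vertices stands for the subgraph of [(X, e)] induced by [A].
   Adjacency is only ever used for symmetric [e]. *)
Section Graphs.
Variables (X : eqType) (e : rel X).

Definition walk (A : set X) (x : X) (p : seq X) (y : X) : Prop :=
  [/\ path e x p, last x p = y & [set` x :: p] `<=` A].

Definition component (A : set X) (x : X) : set X :=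
  [set y | exists p, walk A x p y].

Definition connected (A : set X) : Prop :=
  forall x y, A x -> A y -> component A x y.

Definition bounded (A C : set X) : Prop :=
  exists n : nat, forall x y, C x -> C y ->
    exists2 p, walk A x p y & (size p <= n)%N.

(* Removing from a graph a finite subgraph with vertex set [K] leaves, up to
   bounded pieces of edges, the subgraph induced by the other vertices. *)
Definition unbounded_component (A K : set X) : set (set X) :=
  [set C | (exists2 x, (A `\` K) x & C = component (A `\` K) x) /\
           ~ bounded A C].

Definition one_ended (A : set X) : Prop :=
  infinite_set A /\
  forall K, finite_set K -> K `<=` A -> exists! C, unbounded_component A K C.

Definition many_ended (A : set X) : Prop :=
  exists K, [/\ finite_set K, K `<=` A &
    exists C D, [/\ unbounded_component A K C, unbounded_component A K D &
                    C <> D]].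

Record is_tree : Prop := IsTree {
  tree_sym : symmetric e;
  tree_irr : irreflexive e;
  tree_connected : connected setT;
  tree_acyclic : forall c : seq X, ucycle e c -> (size c <= 2)%N
}.

End Graphs.

(** * Finitely generated and finitely presented groups *)

Section Groups.
Variable G : groupType.
Local Open Scope group_scope.

Definition is_subgroup (H : set G) : Prop :=
  [/\ H 1, forall x y, H x -> H y -> H (x * y) & forall x, H x -> H x^-1].

Definition generates (S : seq G) (H : set G) : Prop :=
  smallest is_subgroup [set` S] = H.

Definition finitely_generated (H : set G) : Prop := exists S, generates S H.

Definition cayley (S : seq G) : rel G :=
  fun x y => (x^-1 * y \in S) || (y^-1 * x \in S).

(* The ends of a finitely generated group do not depend on the generating set,
   so one may be chosen freely. *)
Definition group_one_ended (H : set G) : Prop :=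
  exists2 S, generates S H & one_ended (cayley S) H.

Definition group_many_ended (H : set G) : Prop :=
  exists2 S, generates S H & many_ended (cayley S) H.

(* The letter [(i, false)] is the generator [i], and [(i, true)] its inverse. *)
Definition word (n : nat) := seq ('I_n * bool).

Definition eval_letter n (x : 'I_n -> G) (l : 'I_n * bool) : G :=
  if l.2 then (x l.1)^-1 else x l.1.

Definition eval n (x : 'I_n -> G) (w : word n) : G :=
  \prod_(l <- w) eval_letter x l.

(* Equality in the group with [n] generators and relators [R]. *)
Inductive pres_eq n (R : seq (word n)) : word n -> word n -> Prop :=
| pres_refl w : pres_eq R w w
| pres_sym w1 w2 : pres_eq R w1 w2 -> pres_eq R w2 w1
| pres_trans w1 w2 w3 :
    pres_eq R w1 w2 -> pres_eq R w2 w3 -> pres_eq R w1 w3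
| pres_cancel u v i b :
    pres_eq R (u ++ [:: (i, b); (i, ~~ b)] ++ v) (u ++ v)
| pres_relator u v r : r \in R -> pres_eq R (u ++ r ++ v) (u ++ v).

Definition finitely_presented : Prop :=
  exists n (x : 'I_n -> G) (R : seq (word n)),
    (forall g, exists w, eval x w = g) /\
    (forall w1 w2, eval x w1 = eval x w2 <-> pres_eq R w1 w2).

End Groups.

(** * Splittings *)

Section Splittings.
Variables (G : groupType) (V : eqType) (adj : rel V) (act : G -> V -> V).

Record is_splitting : Prop := IsSplitting {
  splitting_tree : is_tree adj;
  splitting_act1 : forall v, act 1%g v = v;
  splitting_actM : forall g h v, act (g * h)%g v = act g (act h v);
  splitting_adj : forall g u v, adj (act g u) (act g v) = adj u v;
  splitting_noinv : forall g u v, adj u v -> ~ (act g u = v /\ act g v = u)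
}.

Definition edge_stabilizer (a b : V) : set G :=
  [set g | act g @` [set a; b] = [set a; b]].

(* A point of the tree is a vertex or lies in the interior of an edge; in the
   absence of inversions, the latter is fixed exactly when its edge is
   preserved. *)
Definition global_fixed_point : Prop :=
  (exists v, forall g, act g v = v) \/
  (exists a b, adj a b /\ edge_stabilizer a b = setT).

Definition nontrivial : Prop := ~ global_fixed_point.

(* A subtree is a nonempty connected subgraph; in a tree, such a subgraph is
   induced by its set of vertices. *)
Definition minimal : Prop :=
  forall A : set V, A !=set0 -> connected adj A ->
    (forall g v, A v -> A (act g v)) -> A = setT.

Definition delete_edge (a b : V) : rel V :=
  fun x y => adj x y && ((x, y) \notin [:: (a, b); (b, a)]).

(* The vertices of the halfspace bounded by the midpoint of the edge [a b] and
   containing [a]; the other halfspace of that edge is [halfspace b a]. *)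
Definition halfspace (a b : V) : set V := component (delete_edge a b) setT a.

(* Vertices of the corresponding halfspace of the splitting, for the orbit map
   given by the vertex [v]; as a graph, it is induced from a Cayley graph. *)
Definition group_halfspace (v : V) (a b : V) : set G :=
  [set g | halfspace a b (act g v)].

Definition connects_halfspaces (v : V) (S : seq G) : Prop :=
  generates S setT /\
  forall a b, adj a b -> connected (cayley S) (group_halfspace v a b).

End Splittings.

(** * Second cohomology *)

Record gmodule (G : groupType) := GModule {
  gmodule_sort :> zmodType;
  gmodule_act : G -> gmodule_sort -> gmodule_sort;
  gmodule_act1 : forall m, gmodule_act 1%g m = m;
  gmodule_actM : forall g h m,
    gmodule_act (g * h)%g m = gmodule_act g (gmodule_act h m);
  gmodule_actB : forall g m m',
    gmodule_act g (m - m') = gmodule_act g m - gmodule_act g m'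
}.

Section Cohomology.
Variables (G : groupType) (M : gmodule G).
Local Notation act := (@gmodule_act G M).

(* Coboundary maps of the inhomogeneous (bar) cochain complex. *)
Definition d1 (f : G -> M) : G -> G -> M :=
  fun g h => act g (f h) - f (g * h)%g + f g.

Definition d2 (f : G -> G -> M) : G -> G -> G -> M :=
  fun g h k =>
    act g (f h k) - f (g * h)%g k + f g (h * k)%g - f g h.

Lemma gmodule_actD g (m m' : M) : act g (m + m') = act g m + act g m'.
Proof.
have act0 : act g 0 = 0 by rewrite -[X in act g X](subrr 0) gmodule_actB subrr.
by rewrite -{1}[m']opprK -[- m']sub0r !gmodule_actB act0 sub0r opprK.
Qed.

Lemma d1B f f' : d1 (f - f') = d1 f - d1 f'.
Proof.
apply/funext => g; apply/funext => h.
transitivity (d1 f g h - d1 f' g h) => //.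
have fB u : (f - f') u = f u - f' u by [].
rewrite /d1 !fB gmodule_actB !opprD !opprK !addrA.
by rewrite (ACl (1*3*5*2*4*6)).
Qed.

Lemma d2B f f' : d2 (f - f') = d2 f - d2 f'.
Proof.
apply/funext => g; apply/funext => h; apply/funext => k.
transitivity (d2 f g h k - d2 f' g h k) => //.
have fB u v : (f - f') u v = f u v - f' u v by [].
rewrite /d2 !fB gmodule_actB !opprD !opprK !addrA.
by rewrite (ACl (1*3*5*7*2*4*6*8)).
Qed.

Lemma d2_d1 f : d2 (d1 f) = 0.
Proof.
apply/funext => g; apply/funext => h; apply/funext => k.
rewrite /d2 /d1 gmodule_actD gmodule_actB -gmodule_actM !mulgA.
rewrite !opprD !opprK !addrA (ACl (1*4*2*7*3*10*5*8*6*11*9*12)) /=.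
by rewrite !(subrr, add0r, addNr).
Qed.

(* The 2-cocycles, the 2-coboundaries among them, and H^2 = Z^2 / B^2. *)
Definition Z2 : {pred G -> G -> M} := [pred f | `[< d2 f = 0 >]].

Lemma Z2_zmod_closed : zmod_closed Z2.
Proof.
split=> [|f f' /asboolP df /asboolP df']; apply/asboolP.
  by rewrite -(subrr 0) d2B subrr.
by rewrite d2B df df' subrr.
Qed.

HB.instance Definition _ :=
  GRing.isZmodClosed.Build (G -> G -> M) Z2 Z2_zmod_closed.

Record cocycle2 :=
  Cocycle2 { cocycle2_val :> G -> G -> M; _ : cocycle2_val \in Z2 }.
HB.instance Definition _ := [isSub for cocycle2_val].
HB.instance Definition _ := [Choice of cocycle2 by <:].
HB.instance Definition _ := [SubChoice_isSubZmodule of cocycle2 by <:].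

Definition B2 : {pred cocycle2} := [pred f | `[< exists b, val f = d1 b >]].

Lemma B2_zmod_closed : zmod_closed B2.
Proof.
split=> [|f f' /asboolP[b eb] /asboolP[b' eb']]; apply/asboolP.
  by exists 0; rewrite -[X in d1 X](subrr 0) d1B subrr.
by exists (b - b'); rewrite d1B -eb -eb'.
Qed.

HB.instance Definition _ := GRing.isZmodClosed.Build cocycle2 B2 B2_zmod_closed.

Definition H2 : zmodType := (Quotient.quot B2).

Lemma H2_neq0 : (exists x : H2, x != 0) <->
  exists2 f : G -> G -> M, d2 f = 0 & forall b, f <> d1 b.
Proof.
have H2E (f : cocycle2) : (\pi_(Quotient.quot B2) f == 0) = (f \in B2).
  by rewrite -[f in RHS]subr0 Quotient.idealrBE pi_zeror.
split=> [[x]|[f df fb]].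
  rewrite -[x]reprK H2E => xB; exists (repr x).
    by have /asboolP := valP (repr x).
  by move=> b xb; case/negP: xB; apply/asboolP; exists b.
have fZ : f \in Z2 by apply/asboolP.
exists (\pi_(Quotient.quot B2) (Cocycle2 fZ)); rewrite H2E.
by apply/negP => /asboolP[b /fb].
Qed.

End Cohomology.

(* The group ring of [G] as a left module over itself: [{malg int[G]}] is the
   free abelian group on [G], on which [g] sends a basis element [h] to [gh]. *)
Section GroupRing.
Variable G : groupType.

Definition zg_act (g : G) (a : {malg int[G]}) : {malg int[G]} :=
  \sum_(h <- msupp a) << a@_h *g (g * h)%g >>.

Lemma zg_actE g a h : (zg_act g a)@_h = a@_(g^-1 * h)%g.
Proof.
rewrite {2}(monalgE a) /zg_act !raddf_sum /=; apply: eq_bigr => k _.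
by rewrite !mcoeffU -(inj_eq (mulgI g^-1%g)) mulKg.
Qed.

Lemma zg_act1 a : zg_act 1 a = a.
Proof. by apply/malgP => h; rewrite zg_actE invg1 mul1g. Qed.

Lemma zg_actM g h a : zg_act (g * h)%g a = zg_act g (zg_act h a).
Proof. by apply/malgP => k; rewrite !zg_actE invgM mulgA. Qed.

Lemma zg_actB g a b : zg_act g (a - b) = zg_act g a - zg_act g b.
Proof. by apply/malgP => k; rewrite !(zg_actE, mcoeffB). Qed.

Definition ZG : gmodule G := GModule zg_act1 zg_actM zg_actB.

End GroupRing.

(* Main.v *)
(* Write F for the module of all functions G -> Z. As ZG consists of the finitely
   supported ones and F is acyclic, H^2(G, ZG) is H^1(G, F / ZG). Let H be a
   halfspace of the edge e. A second end of G_e gives a function on G_e almost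
   invariant under right translations and not almost constant; extend it to psi
   on G along a transversal of G_e\G. Both d psi and d 1_H have infinite support,
   but d 1_H is supported on finitely many cosets G_e k, along which psi is
   almost invariant; hence the cup product of d psi and d 1_H takes values in ZG.
   In F it is the coboundary of psi * d 1_H up to sign. Were it also one over ZG,
   then psi * d 1_H would be d f up to finite errors, for some f in F. Such an f
   is almost invariant inside each of the two halfspaces, hence almost constant
   there by one-endedness. So psi is almost constant on pairs crossing from one
   halfspace to the other by a fixed g; such pairs contain a whole coset of G_e,
   and the function we started from is almost constant, a contradiction. *)

Require Import Defs.
From HB Require Import structures.
From mathcomp Require Import all_boot all_order all_algebra finmap.
From mathcomp Require Import boolp classical_sets functions cardinality.
From mathcomp.multinomials Require Import monalg.
From mathcomp Require Import ring.

Set Implicit Arguments.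
Unset Strict Implicit.
Unset Printing Implicit Defensive.

Import GRing.Theory.

Local Open Scope classical_set_scope.
Local Open Scope ring_scope.

(** * Components of locally finite graphs and one-endedness *)

Section Components.
Variables (X : eqType) (e : rel X).
Implicit Types (A C K : set X) (x y z : X).

Lemma component_refl A x : A x -> component e A x x.
Proof. by move=> Ax; exists [::]; split=> // y; rewrite /= inE => /eqP->. Qed.

Lemma component_sub A x : component e A x `<=` A.
Proof.
by move=> y [p [_ <- pA]]; apply: pA; rewrite /= mem_last.
Qed.

Lemma component_trans A x y z :
  component e A x y -> component e A y z -> component e A x z.
Proof.
move=> [p [ep py pA]] [q [eq qz qA]]; exists (p ++ q); split.
- by rewrite cat_path ep py.
- by rewrite last_cat py.
- move=> t; rewrite /= -cat_cons mem_cat => /orP[/pA//|tq].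
  by apply: qA; rewrite /= inE tq orbT.
Qed.

Lemma component_edge A x y : A x -> A y -> e x y -> component e A x y.
Proof.
move=> Ax Ay exy; exists [:: y]; split=> //=; first by rewrite exy.
by move=> t; rewrite /= !inE => /orP[]/eqP->.
Qed.

Lemma component_sym A x y :
  symmetric e -> component e A x y -> component e A y x.
Proof.
move=> e_sym [p [ep <-{y} pA]].
elim: p x ep pA => [|z p IH] x /=.
  by move=> _ pA; apply: component_refl; apply: pA; rewrite /= inE.
case/andP=> exz ep pA.
have Az : A z by apply: pA; rewrite /= !inE eqxx orbT.
have Ax : A x by apply: pA; rewrite /= inE eqxx.
apply: (@component_trans _ _ z); last by apply: component_edge; rewrite // e_sym.
by apply: IH => // t /= tp; apply: pA; rewrite /= inE tp orbT.
Qed.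

Lemma component_eq A x y :
  symmetric e -> component e A x y -> component e A x = component e A y.
Proof.
move=> e_sym xy; apply/seteqP; split=> z; apply: component_trans => //.
exact: component_sym.
Qed.

Lemma finite_bounded A C : finite_set C ->
  (forall x y, C x -> C y -> component e A x y) -> bounded e A C.
Proof.
move=> /finite_seqP[s ->] sA.
have walkP x : exists N : X -> nat, forall y, x \in s -> y \in s ->
    exists2 p, walk e A x p y & (size p <= N y)%N.
  have [xs|_] := boolP (x \in s); last by exists (fun=> 0%N).
  have pathP y : exists n, y \in s -> exists2 p, walk e A x p y & (size p <= n)%N.
    have [ys|_] := boolP (y \in s); last by exists 0%N.
    by have [p ?] := sA _ _ xs ys; exists (size p) => _; exists p.
  by have [N NP] := choice pathP; exists N => y _; apply: NP.
have [N NP] := choice walkP.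
exists (\max_(x <- s) \max_(y <- s) N x y)%N => x y /= xs ys.
have [p wp pN] := NP x y xs ys; exists p => //; apply: (leq_trans pN).
apply: (leq_trans (leq_bigmax_seq (F := N x) _ ys isT)).
exact: (leq_bigmax_seq (F := fun z => \max_(t <- s) N z t)%N _ xs isT).
Qed.

Hypothesis loc_fin : forall x, finite_set [set y | e x y].

Lemma finite_ball n x :
  finite_set [set y | exists p, [/\ path e x p, last x p = y & (size p <= n)%N]].
Proof.
elim: n x => [|n IH] x.
  by apply: sub_finite_set (finite_set1 x) => y [[|? ?] [_ <- //]].
apply: sub_finite_set (_ : finite_set ([set x] `|` \bigcup_(z in [set z | e x z])
   [set y | exists p, [/\ path e z p, last z p = y & (size p <= n)%N]])).
  move=> y [[|z p] [/= ep py pn]]; first by left.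
  by case/andP: ep => exz ep; right; exists z => //; exists p.
by rewrite finite_setU; split; [exact: finite_set1 | exact: bigcup_finite].
Qed.

Lemma bounded_finite A C : bounded e A C -> finite_set C.
Proof.
move=> [n Cn]; have [->//|/set0P[x Cx]] := eqVneq C set0.
apply: sub_finite_set (finite_ball n x) => y Cy.
by have [p [? ? _] ?] := Cn x y Cx Cy; exists p.
Qed.

(** Follow the walk towards [y] until its next vertex lies in [K]; if this never happens, the whole
    walk avoids [K]. *)
Lemma component_meets A K x y : component e A x y -> ~ K x ->
  component e (A `\` K) x y \/
  exists z k, [/\ component e (A `\` K) x z, K k & e z k].
Proof.
move=> [p [ep <-{y} pA]].
elim: p x ep pA => [|z p IH] x /= ep pA nKx.
  by left; apply: component_refl; split=> //; apply: pA; rewrite /= inE.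
case/andP: ep => exz ep.
have Az : A z by apply: pA; rewrite /= !inE eqxx orbT.
have Ax : A x by apply: pA; rewrite /= inE eqxx.
have xx : component e (A `\` K) x x by apply: component_refl.
case: (pselect (K z)) => Kz; first by right; exists x, z.
have xz : component e (A `\` K) x z by apply: component_edge.
case: (IH z ep _ Kz) => [t tp|zp|[t [k [zt Kk etk]]]].
- by apply: pA; rewrite /= inE tp orbT.
- by left; apply: component_trans zp.
- by right; exists t, k; split=> //; apply: component_trans zt.
Qed.

(* Only the component of the complement of [K] without bounded diameter is
   infinite; every other one contains a neighbour of [K], so there are finitely
   many of them. *)
Lemma one_ended_almost_constant (Y : Type) (f : X -> Y) A K :
  symmetric e -> connected e A -> one_ended e A -> finite_set K ->
  (forall x y, A x -> A y -> ~ K x -> ~ K y -> e x y -> f x = f y) ->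
  exists c, finite_set [set x | A x /\ f x <> c].
Proof.
move=> e_sym Aconn [_ Aend] Kfin fK.
have [C [[[x0 [Ax0 nKx0] ->] _] Cuniq]] :=
  Aend _ (finite_setIr A Kfin) (@subIsetl _ A K).
have f_comp x y : component e (A `\` (A `&` K)) x y -> f x = f y.
  move=> [p [ep <- pA]]; elim: p x ep pA => [//|z p IH] x /= /andP[exz ep] pA.
  have [Ax Kx] := pA x (mem_head _ _).
  have [|Az Kz] := pA z _; first by rewrite /= !inE eqxx orbT.
  rewrite (fK x z) //; [|by move=> ?; apply: Kx|by move=> ?; apply: Kz].
  by apply: IH => // t tp; apply: pA; rewrite /= inE tp orbT.
exists (f x0).
pose N := \bigcup_(k in K) [set z | e k z].
pose F z := [set x | component e (A `\` (A `&` K)) z x /\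
                     bounded e A (component e (A `\` (A `&` K)) z)].
apply: sub_finite_set (_ : finite_set (K `|` \bigcup_(z in N) F z)); last first.
  rewrite finite_setU; split=> //.
  apply: bigcup_finite => [|z _]; first exact: bigcup_finite.
  have [bd|nbd] := pselect (bounded e A (component e (A `\` (A `&` K)) z)).
    by apply: sub_finite_set (bounded_finite bd) => x [].
  by apply: sub_finite_set (finite_set0 X) => x [_ /nbd].
move=> x [Ax fx]; have [Kx|nKx] := pselect (K x); [by left | right].
have nAKx : ~ (A `&` K) x by case.
have [xx0|[z [k [xz [_ Kk] ezk]]]] := component_meets (Aconn _ _ Ax Ax0) nAKx.
  by case: fx; apply: f_comp.
exists z; first by exists k => //=; rewrite e_sym.
have zx := component_sym e_sym xz.
split=> //; apply: contrapT => nbd; apply: fx; apply: esym; apply: f_comp.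
rewrite (Cuniq (component e (A `\` (A `&` K)) z)) //; split=> //.
by exists z => //; apply: component_sub xz.
Qed.

End Components.

(** * Almost invariant functions and ends of subgroups *)

Section AlmostInvariant.
Variable G : groupType.
Implicit Types (S : seq G) (L : set G) (c : G -> int).

Lemma cayley_sym S : symmetric (cayley S).
Proof. by move=> x y; rewrite /cayley orbC. Qed.

Lemma cayley_locally_finite S x : finite_set [set y | cayley S x y].
Proof.
apply/finite_seqP.
exists ([seq (x * s)%g | s <- S] ++ [seq (x * s^-1)%g | s <- S]).
apply/seteqP; split=> y /=.
  rewrite /cayley mem_cat => /orP[yS|yS]; apply/orP; [left|right];
    apply/mapP; eexists; eauto; first by rewrite mulVKg.
  by rewrite invgM invgK mulVKg.
rewrite /cayley mem_cat => /orP[|] /mapP[s sS ->]; apply/orP; [left|right].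
  by rewrite mulKg.
by rewrite invgM invgK mulgVK.
Qed.

Lemma generates_subgroup S L : generates S L -> is_subgroup L.
Proof.
move=> <-; split=> [H [[]]//|x y xS yS H HS|x xS H HS].
  by have [[_ HM _] _] := HS; apply: HM; [apply: xS | apply: yS].
by have [[_ _ HV] _] := HS; apply: HV; apply: xS.
Qed.

Definition almost_invariant L c : Prop :=
  forall u, L u -> finite_set [set t | L t /\ c (t * u)%g <> c t].

(** The [u] with a finite exceptional set form a subgroup: the set for a product or an inverse is
    covered by the given sets and their translates. *)
Lemma almost_invariant_gen S L c : generates S L ->
  (forall u, u \in S -> finite_set [set t | L t /\ c (t * u)%g <> c t]) ->
  almost_invariant L c.
Proof.
move=> SL cS.
have [L1 LM LV] := generates_subgroup SL.
pose M := [set u | L u /\ finite_set [set t | L t /\ c (t * u)%g <> c t]].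
suff LM' : L `<=` M by move=> u /LM'[].
rewrite -{1}SL; apply: smallest_sub; last first.
  move=> u uS; split; last exact: cS.
  by rewrite -SL => H [_]; apply.
split.
- split=> //; apply: sub_finite_set (finite_set0 G) => t [_].
  by rewrite mulg1.
- move=> x y [Lx fx] [Ly fy]; split; first exact: LM.
  apply: sub_finite_set (_ : finite_set
    ([set t | L t /\ c (t * x)%g <> c t] `|`
     (fun t => t * x^-1)%g @` [set t | L t /\ c (t * y)%g <> c t])).
    move=> t [Lt]; have [e1|n1] := pselect (c (t * x)%g = c t); last by left.
    move=> n2; right; exists (t * x)%g; last by rewrite mulgK.
    by split; [exact: LM | rewrite -mulgA e1].
  by rewrite finite_setU; split=> //; apply: finite_image.
- move=> x [Lx fx]; split; first exact: LV.
  apply: sub_finite_set (finite_image (fun t => t * x)%g fx) => t [Lt ct].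
  exists (t * x^-1)%g; last by rewrite mulgVK.
  by split; [apply: LM => //; exact: LV | rewrite mulgVK; exact: nesym].
Qed.

(** Take the indicator of an unbounded component [C] off [K]: a generator [u] can change it at [t]
    only if [t] or [t * u] lies in [K]. *)
Lemma many_ended_almost_invariant L : group_many_ended L ->
  exists2 c, almost_invariant L c &
    forall n, infinite_set [set t | L t /\ c t <> n].
Proof.
move=> [S SL [K [Kfin KL [C [D [[[x [Lx Kx] eC] Cub] [[y [Ly Ky] eD] Dub] CD]]]]]].
have [L1 LM LV] := generates_subgroup SL.
have infC z : ~ bounded (cayley S) L (component (cayley S) (L `\` K) z) ->
    infinite_set (component (cayley S) (L `\` K) z).
  apply: contra_not => /finite_bounded; apply=> s t zs zt.
  have [p [ep pt pL]] := component_trans (component_sym (cayley_sym S) zs) zt.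
  by exists p; split=> // r /pL[].
have nCD z : C z -> D z -> False.
  rewrite eC eD => xz yz; apply: CD; rewrite eC eD.
  by rewrite (component_eq (@cayley_sym S) xz) (component_eq (@cayley_sym S) yz).
exists (fun t => (`[< C t >])%:R).
  apply: (almost_invariant_gen SL) => u uS.
  have Lu : L u by rewrite -SL => H [_]; apply.
  apply: sub_finite_set (_ : finite_set (K `|` (fun t => t * u^-1)%g @` K)).
    move=> t [Lt ct]; have [Kt|nKt] := pselect (K t); [by left | right].
    have [Ktu|nKtu] := pselect (K (t * u)%g).
      by exists (t * u)%g => //; rewrite mulgK.
    case: ct; congr (_ %:R); congr (nat_of_bool _); apply/asboolP/asboolP.
      rewrite eC => xtu; apply: component_trans xtu _.
      apply: component_edge; [by split=> //; exact: LM | by [] |].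
      by rewrite /cayley invgM mulgVK /= mulKg uS orbT.
    rewrite eC => xt; apply: component_trans xt _.
    apply: component_edge; [by [] | by split=> //; exact: LM |].
    by rewrite /cayley mulKg uS.
  by rewrite finite_setU; split=> //; apply: finite_image.
have CL : C `<=` L by rewrite eC => t /component_sub[].
have DL : D `<=` L by rewrite eD => t /component_sub[].
(* The indicator is 0 on the infinite set [D], which excludes [n = 1], and 1 on the infinite set
   [C], which excludes every other [n]. *)
move=> n fin; have [n1|n1] := eqVneq n 1.
  rewrite eD in Dub nCD DL; apply: (infC _ Dub); apply: sub_finite_set fin.
  move=> t Dt; split; first exact: DL.
  rewrite n1; case: asboolP => // Ct; case: (nCD _ Ct Dt).
rewrite eC in Cub CL; apply: (infC _ Cub); apply: sub_finite_set fin.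
move=> t Ct; split; first exact: CL.
by apply/eqP; rewrite eq_sym asboolT // eC.
Qed.

End AlmostInvariant.

(** * Halfspaces of the tree and the edge stabilizer *)

Section Tree.
Variables (G : groupType) (V : eqType) (adj : rel V) (act : G -> V -> V).
Hypothesis T_splitting : is_splitting adj act.
Variables (a b : V).
Hypothesis ab_edge : adj a b.

Let actK g : cancel (act g) (act g^-1).
Proof.
by move=> x; rewrite -(splitting_actM T_splitting) mulVg (splitting_act1 T_splitting).
Qed.

Let act_inj g : injective (act g).
Proof. exact: can_inj (actK g). Qed.

Let adj_sym : symmetric adj.
Proof. exact: tree_sym (splitting_tree T_splitting). Qed.

Lemma edge_neq : a != b.
Proof.
apply/eqP => ab; move: ab_edge.
by rewrite ab (tree_irr (splitting_tree T_splitting)).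
Qed.

Lemma delete_edgeC : delete_edge adj b a = delete_edge adj a b.
Proof.
by apply/funext => x; apply/funext => y; rewrite /delete_edge !inE orbC.
Qed.

Lemma delete_edge_sym : symmetric (delete_edge adj a b).
Proof.
move=> x y; rewrite /delete_edge adj_sym !inE !xpair_eqE.
by rewrite orbC [X in ~~ (X || _)]andbC [X in ~~ (_ || X)]andbC.
Qed.

(** A common vertex would give a path from [a] to [b] avoiding the edge, which closes up with that
    edge to a cycle. *)
Lemma halfspace_disjoint x : halfspace adj a b x -> halfspace adj b a x -> False.
Proof.
rewrite /halfspace delete_edgeC => ax bx.
have [p [ep pb _]] := component_trans ax (component_sym delete_edge_sym bx).
case/shortenP: ep pb => q eq uq _ qb.
have eq' : path adj a q by apply: sub_path eq => u w /andP[].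
have : ucycle adj (a :: q).
  by apply/andP; split=> //=; rewrite rcons_path eq' qb adj_sym.
move/(tree_acyclic (splitting_tree T_splitting)).
case: q eq qb {uq eq'} => [|c [|//]] /=.
  by move=> _ /eqP; rewrite (negPf edge_neq).
by move=> /andP[+ _] cb _; rewrite cb /delete_edge !inE eqxx andbF.
Qed.

(** By injectivity [t] fixes or swaps the two ends, and a swap would be an inversion. *)
Lemma edge_stabilizerE t :
  edge_stabilizer act a b t <-> act t a = a /\ act t b = b.
Proof.
split=> [tab|[ta tb]]; last first.
  by rewrite /edge_stabilizer /= image_setU !image_set1 ta tb.
have imab x : [set a; b] x -> [set a; b] (act t x).
  by move=> ?; rewrite -tab; exists x.
have ab := elimN eqP edge_neq.
have [ta|ta] := imab a (or_introl erefl);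
  have [tb|tb] := imab b (or_intror erefl) => //.
- by case: ab; apply: (@act_inj t); rewrite ta tb.
- by case: (splitting_noinv T_splitting ab_edge (g := t)).
- by case: ab; apply: (@act_inj t); rewrite ta tb.
Qed.

Lemma halfspace_stable t x : edge_stabilizer act a b t ->
  halfspace adj a b x -> halfspace adj a b (act t x).
Proof.
move=> /edge_stabilizerE[ta tb] [p [ep <- _]]; rewrite /halfspace -{2}ta.
exists (map (act t) p); split=> //; last by rewrite last_map.
rewrite path_map; apply: sub_path ep => u w /=.
rewrite /delete_edge (splitting_adj T_splitting) !inE !xpair_eqE.
by rewrite -{3}ta -{3}tb -{4}ta -{4}tb !(inj_eq (@act_inj t)).
Qed.

(* A segment of the tree contains finitely many edges, and each of them is sent
   to a given edge by the elements of at most two cosets of its stabilizer. *)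
Lemma halfspace_coboundary x p : path adj x p ->
  exists s : seq G, forall y,
    ~ (halfspace adj a b (act y x) <-> halfspace adj a b (act y (last x p))) ->
    exists2 k, k \in s & edge_stabilizer act a b (y * k^-1)%g.
Proof.
elim: p x => [|z p IH] x /=; first by exists [::] => y [].
case/andP=> xz /IH[s sP].
pose E u w := [set y | act y x = u /\ act y z = w].
(* The edge [x z] can be carried to [a b] in two directions, each by at most one coset of the
   stabilizer; [xget] picks a representative, or the default 1 if there is none. *)
exists [:: xget 1%g (E a b), xget 1%g (E b a) & s] => y yxz.
have coset u w : E u w y -> [set u; w] = [set a; b] ->
    edge_stabilizer act a b (y * (xget 1%g (E u w))^-1)%g.
  move=> Ey uw; have [ku kw] := xgetI 1%g Ey; case: Ey => yu yw.
  apply/edge_stabilizerE; rewrite !(splitting_actM T_splitting).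
  have fixu : act y (act (xget 1%g (E u w))^-1 u) = u by rewrite -{2}ku actK.
  have fixw : act y (act (xget 1%g (E u w))^-1 w) = w by rewrite -{2}kw actK.
  have fix_ab c : [set a; b] c -> act y (act (xget 1%g (E u w))^-1 c) = c.
    by rewrite -uw => -[] ->.
  by split; apply: fix_ab; [left | right].
have [zp|nzp] := pselect (halfspace adj a b (act y z) <->
                          halfspace adj a b (act y (last z p))); last first.
  by have [k ks kL] := sP _ nzp; exists k; rewrite // !inE ks !orbT.
have [Eab|nEab] := pselect (E a b y).
  by exists (xget 1%g (E a b)); rewrite ?inE ?eqxx //; apply: coset.
have [Eba|nEba] := pselect (E b a y).
  by exists (xget 1%g (E b a)); rewrite ?inE ?eqxx ?orbT //; apply: coset; rewrite // setUC.
(* Otherwise the image of the edge [x z] survives the deletion, so its ends lie on the same side. *)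
have dxz : delete_edge adj a b (act y x) (act y z).
  rewrite /delete_edge (splitting_adj T_splitting) xz !inE !xpair_eqE /=.
  by apply/negP => /orP[] /andP[/eqP ? /eqP ?]; [apply: nEab | apply: nEba].
case: yxz; apply: iff_trans zp; split=> h; apply: (component_trans h);
  apply: component_edge => //; by rewrite delete_edge_sym.
Qed.

End Tree.

(** * The cup product cocycle and its nontriviality *)

Section CupProduct.
Variables (G : groupType) (L : set G) (c : G -> int).
Hypotheses (L_subgroup : is_subgroup L) (c_inv : almost_invariant L c).

Lemma extend_from_subgroup : exists psi : G -> int,
  forall k, exists2 u, L u & forall t, L t -> psi (t * k)%g = c (t * u)%g.
Proof.
have [L1 LM LV] := L_subgroup.
(* The choice is made from the coset [L x] itself, so [rep (t * k)] equals [rep k] for [t] in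
   [L]. *)
pose rep x := xget 1%g [set k | L (x * k^-1)%g].
exists (fun x => c (x * (rep x)^-1)%g) => k.
exists (k * (rep k)^-1)%g.
  apply: (xgetI (P := [set k' | L (k * k'^-1)%g]) 1%g (x := k)).
  by rewrite /= mulgV.
move=> t Lt; rewrite -mulgA; congr (c (_ * (_ * _^-1))%g).
congr (xget _ _); apply/seteqP; split=> x /= Lx; last first.
  by rewrite -mulgA; apply: LM.
by rewrite -(mulKg t (k * x^-1)%g); apply: LM; [exact: LV | rewrite mulgA].
Qed.

Lemma malg_finite_support (F : G -> int) : finite_set [set x | F x <> 0] ->
  exists m : {malg int[G]}, forall x, m@_x = F x.
Proof.
move=> finF; exists [malg x in fset_set [set x | F x <> 0] => F x] => x.
rewrite mcoeffE in_fset_set //; case: ifPn => //.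
by rewrite notin_setE /= => /contrapT.
Qed.

Variables (psi : G -> int) (H : set G).
Hypothesis psiE :
  forall k, exists2 u, L u & forall t, L t -> psi (t * k)%g = c (t * u)%g.
Hypothesis H_coboundary : forall g, exists s : seq G, forall y,
  ~ (H y <-> H (y * g)%g) -> exists2 k, k \in s & L (y * k^-1)%g.

(** Each side is a right translate of [c] by an element of [L], so it differs from [c t] for only
    finitely many [t]. *)
Lemma extension_almost_invariant k k' :
  finite_set [set t | L t /\ psi (t * k)%g <> psi (t * k')%g].
Proof.
have [u Lu uE] := psiE k; have [u' Lu' uE'] := psiE k'.
apply: sub_finite_set (_ : finite_set ([set t | L t /\ c (t * u)%g <> c t] `|`
                                       [set t | L t /\ c (t * u')%g <> c t])).
  move=> t [Lt]; rewrite uE // uE' //.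
  have [->|] := pselect (c (t * u)%g = c t); last by left.
  by move=> /nesym; right.
by rewrite finite_setU; split; apply: c_inv.
Qed.

Let ind y : int := (`[< H y >])%:R.

(* The cup product of the coboundaries of [psi] and of the indicator of [H],
   read through the inversion of [G] to turn right into left translations. *)
Lemma cup_product_exists : exists Phi : G -> G -> {malg int[G]}, forall g h x,
  (Phi g h)@_x = (psi (x^-1 * g)%g - psi x^-1%g) *
                 (ind (x^-1 * g * h)%g - ind (x^-1 * g)%g).
Proof.
suff PhiP g : exists Phi : G -> {malg int[G]}, forall h x,
  (Phi h)@_x = (psi (x^-1 * g)%g - psi x^-1%g) *
               (ind (x^-1 * g * h)%g - ind (x^-1 * g)%g).
  by have [Phi ?] := choice PhiP; exists Phi.
suff PhiP h : exists m : {malg int[G]}, forall x,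
  m@_x = (psi (x^-1 * g)%g - psi x^-1%g) *
               (ind (x^-1 * g * h)%g - ind (x^-1 * g)%g).
  by have [Phi ?] := choice PhiP; exists Phi.
apply: malg_finite_support; have [s sP] := H_coboundary h.
(* A jump of [ind] forces [x^-1 * g = t * k] with [t] in [L] and [k] in [s]; the other factor then
   compares [psi] at [t * k] and [t * (k * g^-1)]. *)
apply: sub_finite_set (_ : finite_set (\bigcup_(k in [set` s])
  (fun t => (t * (k * g^-1))^-1)%g @`
    [set t | L t /\ psi (t * k)%g <> psi (t * (k * g^-1))%g])).
  move=> x /= /eqP; rewrite mulf_eq0 negb_or !subr_eq0 => /andP[/eqP psix /eqP indx].
  have [|k ks Lk] := sP (x^-1 * g)%g.
    by move=> HH; apply: indx; rewrite /ind (asbool_equiv_eq HH).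
  exists k => //; exists (x^-1 * g * k^-1)%g; last first.
    by rewrite !mulgA mulgVK mulgK invgK.
  by split=> //; rewrite !mulgA mulgVK mulgK.
apply: bigcup_finite => [|k _]; first by apply/finite_seqP; exists s.
by apply: finite_image; apply: extension_almost_invariant.
Qed.

Variables (H' : set G).
Hypotheses (HL : forall t x, L t -> H x -> H (t * x)%g).
Hypotheses (H'L : forall t x, L t -> H' x -> H' (t * x)%g).
Hypotheses (H0 : H !=set0) (H'0 : H' !=set0).
Hypothesis HH' : forall x, H x -> H' x -> False.

(** One-endedness in functional form. Values are compared only where the translate stays in [A],
    since a halfspace is not invariant under right translations. *)
Definition almost_constants_only (A : set G) : Prop := forall f : G -> int,
  (forall s, finite_set [set x | [/\ A x, A (x * s)%g & f (x * s)%g <> f x]]) ->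
  exists n, finite_set [set x | A x /\ f x <> n].

Hypotheses (H_const : almost_constants_only H).
Hypotheses (H'_const : almost_constants_only H').
Hypothesis c_nonconst : forall n, infinite_set [set t | L t /\ c t <> n].

Lemma cup_product_neq0 : exists x : H2 (ZG G), x != 0.
Proof.
have [L1 LM LV] := L_subgroup.
have [Phi PhiE] := cup_product_exists.
apply/H2_neq0; exists Phi.
  apply/funext => g; apply/funext => h; apply/funext => k; apply/malgP => x.
  rewrite /d2 /= !(mcoeffB, mcoeffD) zg_actE !PhiE mcoeff0 invgM invgK !mulgA.
  have cancel (p q r i j l : int) : (r - q) * (l - j) - (r - p) * (l - j) +
      (q - p) * (l - i) - (q - p) * (j - i) = 0 by ring.
  exact: cancel.
move=> B PhiB.
(* Taking coefficients at 1 in the coboundary equation leaves terms with [psi 1]; [f] absorbs them,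
   so that [psi] times the coboundary of [ind] is that of [f] up to a coefficient of [B g], nonzero
   for finitely many [y]. *)
pose f y := psi 1%g * (ind y - ind 1%g) - (B y : {malg int[G]})@_1%g.
have fB g y : psi y * (ind (y * g)%g - ind y) =
              f (y * g)%g - f y + (B g : {malg int[G]})@_(y^-1)%g.
  have := congr1 (fun m : {malg int[G]} => m@_1%g) (congr1 (fun F => F y g) PhiB).
  rewrite /d1 /= !(mcoeffB, mcoeffD) zg_actE PhiE invg1 !mul1g mulg1 /f.
  have rearrange (p q i j l r t u : int) : (q - p) * (l - j) = r - t + u ->
      q * (l - j) = p * (l - i) - t - (p * (j - i) - u) + r.
    by move=> E; transitivity (p * (l - j) + (q - p) * (l - j)); [|rewrite E]; ring.
  exact: rearrange.
have finB g : finite_set [set y | (B g : {malg int[G]})@_(y^-1)%g <> 0].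
  apply: sub_finite_set
    (finite_image (fun x => x^-1)%g (finite_fset (msupp (B g : {malg int[G]})))).
  move=> y /eqP By; exists y^-1%g; last by rewrite invgK.
  by rewrite /= -mcoeff_neq0.
have f_const A : almost_constants_only A ->
    (forall x y, A x -> A y -> ind x = ind y) ->
    exists n, finite_set [set x | A x /\ f x <> n].
  move=> Aconst indA; apply: Aconst => s.
  apply: sub_finite_set (finB s) => y [Ay Ays] fy By; apply: fy.
  by have := fB s y; rewrite By (indA _ _ Ays Ay) subrr mulr0 addr0 => /esym/subr0_eq.
have indH x : H x -> ind x = 1 by move=> ?; rewrite /ind asboolT.
have indH' x : H' x -> ind x = 0.
  by move=> H'x; rewrite /ind asboolF // => Hx; apply: HH' H'x.
have [n Hn] := f_const _ H_const (fun x y Hx Hy => etrans (indH x Hx) (esym (indH y Hy))).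
have [n' Hn'] :=
  f_const _ H'_const (fun x y Hx Hy => etrans (indH' x Hx) (esym (indH' y Hy))).
have [[k Hk] [k' H'k']] := (H0, H'0).
have [u Lu psi_k'] := psiE k'.
(* Crossing from [H'] to [H] by [k'^-1 * k] raises [ind] by 1, so there [psi] equals [n - n'] up to
   finite errors. The point [y = t * u^-1 * k'] makes such a crossing for every [t] in [L], with
   [psi y = c t]. *)
apply: (c_nonconst (n := n - n')).
apply: sub_finite_set (_ : finite_set
  ((fun y => y * k'^-1 * u)%g @` (
     [set y | (B (k'^-1 * k)%g : {malg int[G]})@_(y^-1)%g <> 0] `|`
     [set x | H' x /\ f x <> n'] `|`
     (fun x => x * (k'^-1 * k)^-1)%g @` [set x | H x /\ f x <> n]))); last first.
  by apply: finite_image; rewrite !finite_setU; split; [split|apply: finite_image].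
move=> t [Lt ct]; pose y := (t * u^-1 * k')%g.
have Ltu : L (t * u^-1)%g by apply: LM => //; apply: LV.
exists y; last by rewrite /y mulgK mulgVK.
have yg : (y * (k'^-1 * k))%g = (t * u^-1 * k)%g by rewrite /y !mulgA mulgK.
have Hyg : H (y * (k'^-1 * k))%g by rewrite yg; apply: HL.
have H'y : H' y by apply: H'L.
have [By|?] := pselect ((B (k'^-1 * k)%g : {malg int[G]})@_(y^-1)%g = 0); last by left; left.
have [fy|?] := pselect (f y = n'); last by left; right.
right; exists (y * (k'^-1 * k))%g; last by rewrite mulgK.
split=> // fyg; apply: ct.
have := fB (k'^-1 * k)%g y.
rewrite (indH _ Hyg) (indH' _ H'y) By fy fyg subr0 mulr1 addr0 => <-.
by rewrite /y psi_k' // mulgVK.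
Qed.

End CupProduct.

(** * One-ended halfspaces and the nonvanishing of $H^2$ *)

Lemma one_ended_almost_constants_only (G : groupType) (S : seq G) (A : set G) :
  connected (cayley S) A -> one_ended (cayley S) A -> almost_constants_only A.
Proof.
move=> Aconn Aend f fS.
(* As there are finitely many generators, [K] is finite; [f] is constant along the edges of [A]
   outside [K]. *)
pose K := \bigcup_(s in [set` S]) [set x | [/\ A x, A (x * s)%g & f (x * s)%g <> f x]].
apply: (one_ended_almost_constant (@cayley_locally_finite _ S) (K := K)) => //.
- exact: cayley_sym.
- by apply: bigcup_finite => //; apply/finite_seqP; exists S.
have step x y : A x -> A y -> ~ K x -> (x^-1 * y)%g \in S -> f x = f y.
  move=> Ax Ay Kx xyS; apply: contrapT => /nesym fxy; apply: Kx.
  by exists (x^-1 * y)%g => //; rewrite /= mulVKg.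
by move=> x y Ax Ay Kx Ky /orP[]; [|move=> ?; apply: esym]; apply: step.
Qed.

Theorem corollary1p5 (G : groupType)
    (V : eqType) (adj : rel V) (act : G -> V -> V)
    (G_fp : finitely_presented G)
    (G_one_ended : group_one_ended [set: G])
    (T_splitting : is_splitting adj act)
    (T_nontrivial : nontrivial adj act)
    (T_minimal : minimal adj act)
    (edges_fg : forall a b, adj a b ->
      finitely_generated (edge_stabilizer act a b))
    (a b : V) (ab_edge : adj a b)
    (e_many_ended : group_many_ended (edge_stabilizer act a b))
    (v : V) (S : seq G)
    (S_connects : connects_halfspaces adj act v S)
    (half_ab : one_ended (cayley S) (group_halfspace adj act v a b))
    (half_ba : one_ended (cayley S) (group_halfspace adj act v b a)) :
  exists x : H2 (ZG G), x != 0.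
Proof.
have ba_edge : adj b a by rewrite (tree_sym (splitting_tree T_splitting)).
have L_subgroup : is_subgroup (edge_stabilizer act a b).
  by have [? /generates_subgroup] := e_many_ended.
have [_ S_conn] := S_connects.
have [c c_inv c_nonconst] := many_ended_almost_invariant e_many_ended.
have [psi psiE] := extend_from_subgroup c L_subgroup.
have H_coboundary g : exists s : seq G, forall y,
    ~ (group_halfspace adj act v a b y <->
       group_halfspace adj act v a b (y * g)%g) ->
    exists2 k, k \in s & edge_stabilizer act a b (y * k^-1)%g.
  (* The tree path from [v] to [act g v], translated by [y], joins the images of [v] under [y] and
     [y * g]. *)
  have [p [ep pg _]] := tree_connected (splitting_tree T_splitting)
    (x := v) (y := act g v) I I.
  have [s sP] := halfspace_coboundary T_splitting ab_edge ep; exists s => y.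
  rewrite /group_halfspace /= (splitting_actM T_splitting) -pg; exact: sP.
apply: (cup_product_neq0 L_subgroup c_inv psiE H_coboundary
          (H' := group_halfspace adj act v b a)) => //.
- move=> t x Lt; rewrite /group_halfspace /= (splitting_actM T_splitting).
  exact: halfspace_stable.
- move=> t x Lt; rewrite /group_halfspace /= (splitting_actM T_splitting).
  by apply: halfspace_stable => //; rewrite /edge_stabilizer /= setUC.
- by apply: infinite_setN0; case: half_ab.
- by apply: infinite_setN0; case: half_ba.
- by move=> x; apply: (halfspace_disjoint T_splitting ab_edge).
- by apply: one_ended_almost_constants_only half_ab; apply: S_conn.
- by apply: one_ended_almost_constants_only half_ba; apply: S_conn.
Qed.
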